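(* Let $n\ge 2$, let $q_i\in\mathbb{R}$ for $1\le i\le n$ and $q_{i,j}=q_{j,i}\in\mathbb{R}$ for $i\ne j$, and let $f:\{0,1\}^n\to\mathbb{R}$ be the QUBO objective $f(x)=\sum_{i=1}^n q_i x_i+\frac12\sum_{i=1}^n\sum_{j\neq i} q_{i,j}x_ix_j$, to be maximized. Let $x\in\{0,1\}^n$ be locally optimal with respect to a 1-flip search, and let $S\subseteq N=\{1,\dots,n\}$ with $|S|=r$. If the $r$-flip move on $S$ is improving, i.e. $f(x')>f(x)$ where $x'$ is obtained from $x$ by flipping exactly the coordinates in $S$, then $$\sum_{i\in S}|E(x_i)|<M,$$ where $M=\varphi\cdot\binom{r}{2}$ and $\varphi=\max_{i,j\in N,\ i\ne j}|q_{i,j}|$.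
   Context: For $x\in\{0,1\}^n$ and $i\in N=\{1,\dots,n\}$, the derivative of $f$ at $x$ with respect to coordinate $i$ is $E(x_i)=q_i+\sum_{j<i}q_{j,i}x_j+\sum_{j>i}q_{i,j}x_j$ (it depends on the whole vector $x$). Flipping coordinate $i$ means replacing $x_i$ by $1-x_i$. The vector $x$ is locally optimal with respect to a 1-flip search if no flip of a single coordinate strictly increases $f$; equivalently, for every $i$, either $x_i=0$ and $E(x_i)\le 0$, or $x_i=1$ and $E(x_i)\ge 0$. *)

(* Defs.v *)
From mathcomp Require Import all_boot all_order all_algebra.
From mathcomp Require Import reals.

Set Implicit Arguments.
Unset Strict Implicit.
Unset Printing Implicit Defensive.

Import Order.TTheory GRing.Theory Num.Theory.
Local Open Scope ring_scope.

(* Points of {0,1}^n are boolean functions x : {ffun 'I_n -> bool}, the real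
   value of the coordinate x_i being (x i)%:R; N = {1, ..., n} is 'I_n.
   The linear coefficients are q1 i and the quadratic ones are q2 i j with
   i != j; no definition below reads the diagonal q2 i i. *)

Definition qubo (R : realType) (n : nat) (q1 : 'I_n -> R)
    (q2 : 'I_n -> 'I_n -> R) (x : {ffun 'I_n -> bool}) : R :=
  \sum_(i < n) q1 i * (x i)%:R
  + 2^-1 * \sum_(i < n) \sum_(j < n | j != i) q2 i j * (x i)%:R * (x j)%:R.

Definition deriv_at (R : realType) (n : nat) (q1 : 'I_n -> R)
    (q2 : 'I_n -> 'I_n -> R) (x : {ffun 'I_n -> bool}) (i : 'I_n) : R :=
  q1 i + \sum_(j < n | (j < i)%N) q2 j i * (x j)%:R
       + \sum_(j < n | (i < j)%N) q2 i j * (x j)%:R.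

Definition flip (n : nat) (S : {set 'I_n}) (x : {ffun 'I_n -> bool}) :
    {ffun 'I_n -> bool} :=
  [ffun i => if i \in S then ~~ x i else x i].

Definition locally_optimal_1flip (R : realType) (n : nat)
    (f : {ffun 'I_n -> bool} -> R) (x : {ffun 'I_n -> bool}) : Prop :=
  forall i : 'I_n, ~ (f x < f (flip [set i] x)).

(* The default value 0 does not affect the maximum when 2 <= n: the index set
   is then nonempty and all the terms are nonnegative. *)
Definition max_abs_offdiag (R : realType) (n : nat)
    (q2 : 'I_n -> 'I_n -> R) : R :=
  \big[Num.max/0]_(p : 'I_n * 'I_n | p.1 != p.2) `|q2 p.1 p.2|.

(* Main.v *)
(* Write d = y - x. Since f is quadratic, f(y) - f(x) = sum_i d_i E(x_i)
   + (1/2) sum_{i <> j} q_ij d_i d_j. For a single flip the second sum is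
   empty, so local optimality says d_i E(x_i) <= 0, i.e. d_i E(x_i) = -|E(x_i)|.
   For the flip of S the first sum is therefore -sum_{i in S} |E(x_i)|, and the
   second has r(r-1) nonzero terms, each at most phi. *)

Require Import Defs.
From mathcomp Require Import all_boot all_order all_algebra.
From mathcomp Require Import reals.
From mathcomp Require Import ring lra.

Set Implicit Arguments.
Unset Strict Implicit.
Unset Printing Implicit Defensive.

Import Order.TTheory GRing.Theory Num.Theory.
Local Open Scope ring_scope.

(** Symmetry turns the coefficients [q2 j i] with [j < i] into [q2 i j], so the two ordered sums
    merge into one over [j != i], the index set used in [qubo]. *)
Lemma deriv_atE (R : realType) (n : nat) (q1 : 'I_n -> R)
    (q2 : 'I_n -> 'I_n -> R) (x : {ffun 'I_n -> bool}) (i : 'I_n) :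
    (forall i j : 'I_n, i != j -> q2 i j = q2 j i) ->
  deriv_at q1 q2 x i = q1 i + \sum_(j < n | j != i) q2 i j * (x j)%:R.
Proof.
move=> q2_sym; rewrite /deriv_at -addrA; congr (_ + _).
rewrite [RHS](bigID (fun j : 'I_n => (j < i)%N)) /=; congr (_ + _).
  apply: eq_big => [j|j lt_ji].
    by rewrite -(inj_eq val_inj) /=; case: ltngtP.
  by rewrite q2_sym // -(inj_eq val_inj) /= ltn_eqF.
by apply: eq_bigl => j; rewrite -(inj_eq val_inj) /=; case: ltngtP.
Qed.

(** This is the exact second-order Taylor expansion at [x]. Substituting [y = x + d] produces two
    mixed sums in [x] and [d]; they agree by symmetry, so the factor [2^-1] leaves exactly one, the
    quadratic part of the derivative term. *)
Lemma qubo_sub (R : realType) (n : nat) (q1 : 'I_n -> R)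
    (q2 : 'I_n -> 'I_n -> R) (x y : {ffun 'I_n -> bool}) :
    (forall i j : 'I_n, i != j -> q2 i j = q2 j i) ->
  let d i : R := (y i)%:R - (x i)%:R in
  qubo q1 q2 y - qubo q1 q2 x = \sum_(i < n) d i * deriv_at q1 q2 x i
    + 2^-1 * \sum_(i < n) \sum_(j < n | j != i) q2 i j * d i * d j.
Proof.
move=> q2_sym d.
have cross_sym : \sum_(i < n) \sum_(j < n | j != i) q2 i j * (x i)%:R * d j =
    \sum_(i < n) \sum_(j < n | j != i) q2 i j * d i * (x j)%:R.
  rewrite (exchange_big_dep xpredT) //=; apply: eq_bigr => i _.
  apply: eq_big => [j|j]; rewrite eq_sym // => ji.
  by rewrite q2_sym // mulrAC.
have quad : \sum_(i < n) \sum_(j < n | j != i) q2 i j * (y i)%:R * (y j)%:R =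
    \sum_(i < n) \sum_(j < n | j != i) q2 i j * (x i)%:R * (x j)%:R
    + \sum_(i < n) \sum_(j < n | j != i) q2 i j * (x i)%:R * d j
    + \sum_(i < n) \sum_(j < n | j != i) q2 i j * d i * (x j)%:R
    + \sum_(i < n) \sum_(j < n | j != i) q2 i j * d i * d j.
  rewrite -!big_split; apply: eq_bigr => i _ /=.
  by rewrite -!big_split; apply: eq_bigr => j _ /=; rewrite /d; ring.
have lin : \sum_(i < n) q1 i * (y i)%:R =
    \sum_(i < n) q1 i * (x i)%:R + \sum_(i < n) q1 i * d i.
  by rewrite -big_split; apply: eq_bigr => i _ /=; rewrite /d; ring.
have deriv : \sum_(i < n) d i * deriv_at q1 q2 x i = \sum_(i < n) q1 i * d i
    + \sum_(i < n) \sum_(j < n | j != i) q2 i j * d i * (x j)%:R.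
  rewrite -big_split; apply: eq_bigr => i _ /=.
  rewrite deriv_atE // mulrDr mulrC mulr_sumr; congr (_ + _).
  by apply: eq_bigr => j _; ring.
rewrite /qubo quad lin deriv cross_sym; lra.
Qed.

Lemma flip_sub (R : realType) (n : nat) (S : {set 'I_n})
    (x : {ffun 'I_n -> bool}) (i : 'I_n) :
  (flip S x i)%:R - (x i)%:R = (if i \in S then (-1) ^+ x i else 0) :> R.
Proof.
by rewrite ffunE; case: ifP => _; case: (x i); rewrite ?subrr ?subr0 ?sub0r.
Qed.

Lemma locally_optimal_deriv (R : realType) (n : nat) (q1 : 'I_n -> R)
    (q2 : 'I_n -> 'I_n -> R) (x : {ffun 'I_n -> bool}) (i : 'I_n) :
    (forall i j : 'I_n, i != j -> q2 i j = q2 j i) ->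
    locally_optimal_1flip (qubo q1 q2) x ->
  (-1) ^+ x i * deriv_at q1 q2 x i = - `|deriv_at q1 q2 x i|.
Proof.
move=> q2_sym /(_ i) /negP; rewrite -leNgt -subr_le0 qubo_sub //=.
(* Two distinct indices cannot both equal [i], so every product of two differences has a zero
   factor. *)
rewrite [X in _ + _ * X]big1 => [|k _]; last first.
  apply: big1 => j jk; rewrite !flip_sub !inE.
  by case: (eqVneq k i) jk => [-> /negPf->|_ _]; rewrite ?(mulr0, mul0r).
rewrite mulr0 addr0 (bigD1 i) //= big1 => [|j ji]; last first.
  by rewrite flip_sub inE (negPf ji) mul0r.
rewrite addr0 flip_sub set11 => le0.
(* The sign does not change the absolute value, and the signed derivative is nonpositive by
   [le0]. *)
by rewrite -(normrMsign (x i)) ler0_norm ?opprK.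
Qed.

Lemma sum_offdiag_le (R : realType) (n : nat) (q2 : 'I_n -> 'I_n -> R)
    (S : {set 'I_n}) (d : 'I_n -> R) :
    (forall i, `|d i| = (i \in S)%:R) ->
  \sum_(i < n) \sum_(j < n | j != i) q2 i j * d i * d j
    <= max_abs_offdiag q2 * ('C(#|S|, 2))%:R *+ 2.
Proof.
move=> norm_d; set phi := max_abs_offdiag q2.
(* The bound is spread over the same index pairs as the left side, so that the comparison becomes
   termwise. *)
have -> : phi * ('C(#|S|, 2))%:R *+ 2 =
    \sum_(i < n) \sum_(j < n | j != i) phi * (i \in S)%:R * (j \in S)%:R.
  transitivity (\sum_(i in S) phi * (#|S|.-1)%:R).
    rewrite sumr_const -mulrnAr -mulrnAr -!mulrnA mulnC.
    (* With [r = #|S|], this is [r * (r - 1) = 2 * 'C(r, 2)]. *)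
    by rewrite -mul_bin_diag bin1 mulnC.
  rewrite big_mkcond; apply: eq_bigr => i _ /=.
  rewrite -mulr_sumr; case: ifP => [iS|_]; last by rewrite mulr0 mul0r.
  (* For [i] in [S], the partners [j != i] in [S] form [S :\ i], which has [#|S|.-1] elements. *)
  rewrite mulr1; congr (_ * _); rewrite (cardsD1 i S) iS /= -sum1_card natr_sum.
  rewrite big_mkcond [RHS]big_mkcond; apply: eq_bigr => j _.
  by rewrite !inE; case: eqP => //= _; case: (j \in S).
apply: ler_sum => i _; apply: ler_sum => j ji.
rewrite -!norm_d; apply: le_trans (ler_norm _) _; rewrite !normrM.
rewrite !ler_wpM2r //.
by rewrite /phi /max_abs_offdiag (bigD1 (i, j)) 1?eq_sym //= le_max lexx.
Qed.

Theorem proposition1 (R : realType) (n : nat) (hn : (2 <= n)%N)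
    (q1 : 'I_n -> R) (q2 : 'I_n -> 'I_n -> R)
    (q2_sym : forall i j : 'I_n, i != j -> q2 i j = q2 j i)
    (x : {ffun 'I_n -> bool})
    (x_opt : locally_optimal_1flip (qubo q1 q2) x)
    (r : nat) (S : {set 'I_n}) (card_S : #|S| = r)
    (S_improving : qubo q1 q2 (flip S x) > qubo q1 q2 x) :
  \sum_(i in S) `|deriv_at q1 q2 x i| < max_abs_offdiag q2 * ('C(r, 2))%:R.
Proof.
subst r.
have := S_improving; rewrite -subr_gt0 qubo_sub //=.
have -> : \sum_(i < n) ((flip S x i)%:R - (x i)%:R) * deriv_at q1 q2 x i =
    - \sum_(i in S) `|deriv_at q1 q2 x i|.
  rewrite -sumrN [RHS]big_mkcond; apply: eq_bigr => i _; rewrite flip_sub.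
  by case: ifP => _; rewrite ?mul0r // locally_optimal_deriv.
have norm_d i : `|(flip S x i)%:R - (x i)%:R : R| = (i \in S)%:R.
  by rewrite flip_sub; case: ifP => _; rewrite ?normr0 // normr_sign.
(* The factor [2^-1] cancels the doubling in the bound; strictness comes from the strict
   improvement. *)
have := sum_offdiag_le q2 norm_d; lra.
Qed.
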